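(* Let $n\ge 1$, let $Z_1,\dots,Z_n$ be nonempty compact Hausdorff spaces, $Z=\prod_{j=1}^n Z_j$, and let $u_i:Z\to[0,1]$, $i=1,\dots,n$, be continuous functions. Let $\star$ and $\ast$ be two continuous triangular norms. For $(\nu_1,\dots,\nu_n)\in\prod_{j=1}^n M_\cup Z_j$ put $$eu_i(\nu_1,\dots,\nu_n)=\int_Z^{\vee\star}u_i\,d(\nu_1\circledast\dots\circledast\nu_n),$$ where the integral is the t-normed integral generated by $\star$ and $\circledast$ is the tensor product of possibility capacities generated by $\ast$. Then the game with expected payoff functions $eu_i:\prod_{j=1}^n M_\cup Z_j\to[0,1]$, $i=1,\dots,n$, has a Nash min-equilibrium point; that is, there exists $(\nu_1,\dots,\nu_n)\in\prod_{j=1}^n M_\cup Z_j$ such that for every $i\in\{1,\dots,n\}$ and every $\nu_i'\in M_\cup Z_i$, $$eu_i(\nu_1,\dots,\nu_{i-1},\nu_i',\nu_{i+1},\dots,\nu_n)\ \ge\ eu_i(\nu_1,\dots,\nu_n).$$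
   Context: A triangular norm (t-norm) is a binary operation $\ast$ on $[0,1]$ that is associative, commutative, monotone (nondecreasing in each argument) and satisfies $s\ast 1=s$ for all $s\in[0,1]$; it is continuous if it is continuous as a map $[0,1]^2\to[0,1]$. For a compact Hausdorff space $X$, let $\mathcal F(X)$ be the family of all closed subsets of $X$. A capacity on $X$ is a function $\nu:\mathcal F(X)\to[0,1]$ such that (1) $\nu(X)=1$, $\nu(\emptyset)=0$; (2) $F\subset G$ implies $\nu(F)\le\nu(G)$; (3) if $\nu(F)<a$, then there is an open set $O\supset F$ such that $\nu(B)<a$ for each closed $B\subset O$. A capacity $\nu$ is a possibility capacity if for every family $\{A_t\}_{t\in T}$ of closed sets with closed union, $\nu(\bigcup_t A_t)=\sup_t\nu(A_t)$ (for capacities this is equivalent to $\nu(A\cup B)=\max\{\nu(A),\nu(B)\}$ for all closed $A,B$). $M_\cup X$ is the set of possibility capacities on $X$. The density of $\nu\in M_\cup X$ is the upper semicontinuous function $[\nu]:X\to[0,1]$, $[\nu](x)=\nu(\{x\})$; one has $\nu(F)=\max\{[\nu](x)\mid x\in F\}$ for nonempty closed $F$, and every upper semicontinuous $f:X\to[0,1]$ with $\max f=1$ is the density of a unique possibility capacity. For a continuous t-norm $\star$, a capacity $\mu$ on $X$ and a continuous $f:X\to[0,1]$, the t-normed integral is $\int_X^{\vee\star}f\,d\mu=\max\{\mu(f^{-1}([t,+\infty)))\star t\mid t\in[0,1]\}$. For a continuous t-norm $\ast$ and $\nu_j\in M_\cup Z_j$, the tensor product $\nu_1\circledast\dots\circledast\nu_n\in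 M_\cup(Z_1\times\dots\times Z_n)$ generated by $\ast$ is the possibility capacity with density $[\nu_1\circledast\dots\circledast\nu_n](z_1,\dots,z_n)=[\nu_1](z_1)\ast\dots\ast[\nu_n](z_n)$. *)

(* Defs.v *)
From HB Require Import structures.
From mathcomp Require Import all_boot all_order all_algebra.
From mathcomp Require Import all_classical all_reals all_analysis.
Import Order.TTheory GRing.Theory Num.Theory.
Import numFieldNormedType.Exports.

Set Implicit Arguments.
Unset Strict Implicit.
Unset Printing Implicit Defensive.

Local Open Scope classical_set_scope.
Local Open Scope ring_scope.

(* A binary operation on [0,1] is represented by a function R -> R -> R whose
   values outside the unit square are irrelevant. *)
Record continuous_tnorm (R : realType) (T : R -> R -> R) : Prop := {
  tnorm_itv : {in `[0, 1] &, forall x y, T x y \in `[0, 1]} ;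
  tnormA : {in `[0, 1] & &, associative T} ;
  tnormC : {in `[0, 1] &, commutative T} ;
  tnorm_le : forall x x' y y',
    x \in `[0, 1] -> x' \in `[0, 1] -> y \in `[0, 1] -> y' \in `[0, 1] ->
    x <= x' -> y <= y' -> T x y <= T x' y' ;
  tnormx1 : {in `[0, 1], right_id 1 T} ;
  tnorm_continuous :
    {within `[0, 1]%classic `*` `[0, 1]%classic,
      continuous (fun p : R * R => T p.1 p.2)} }.

(* A set function defined on closed sets is represented by a function on all
   sets whose values on non-closed sets are irrelevant. *)
Record is_capacity (R : realType) (X : topologicalType) (nu : set X -> R) :
    Prop := {
  capacity_itv : forall F, closed F -> nu F \in `[0, 1] ;
  capacityT : nu setT = 1 ;
  capacity0 : nu set0 = 0 ;
  capacity_le : forall F G, closed F -> closed G -> F `<=` G -> nu F <= nu G ;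
  capacity_usc : forall F a, closed F -> nu F < a ->
    exists O, [/\ open O, F `<=` O &
      forall B, closed B -> B `<=` O -> nu B < a] }.

(* For the empty family the supremum is sup set0 = 0, as it is in [0,1]. *)
Record is_possibility (R : realType) (X : topologicalType) (nu : set X -> R) :
    Prop := {
  possibility_is_capacity : is_capacity nu ;
  possibility_bigcup : forall (I : Type) (A : I -> set X),
    (forall i, closed (A i)) -> closed (\bigcup_i A i) ->
    nu (\bigcup_i A i) = sup [set nu (A i) | i in [set: I]] }.

Record possibility (R : realType) (X : topologicalType) := Possibility {
  possibility_fun :> set X -> R ;
  possibilityP : is_possibility possibility_fun }.

Definition density (R : realType) (X : topologicalType) (nu : set X -> R)
  (x : X) : R := nu [set x].

(* The supremum is a maximum: see tint_max. *)
Definition tint (R : realType) (T : R -> R -> R) (X : topologicalType)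
    (mu : set X -> R) (f : X -> R) : R :=
  sup [set T (mu (f @^-1` `[t, +oo[%classic)) t | t in `[0, 1]%classic].

Definition tensor_density (R : realType) (T : R -> R -> R) (n : nat)
    (Z : 'I_n -> topologicalType) (nu : forall j, possibility R (Z j))
    (z : prod_topology Z) : R :=
  \big[T/1]_(j < n) density (nu j) (z j).

(* The possibility capacity with density tensor_density T nu, given by
   F |-> max_F (tensor_density T nu): see tensor_is_possibility and
   density_tensor, and possibility_eq for uniqueness. *)
Definition tensor (R : realType) (T : R -> R -> R) (n : nat)
    (Z : 'I_n -> topologicalType) (nu : forall j, possibility R (Z j))
    (F : set (prod_topology Z)) : R :=
  sup (tensor_density T nu @` F).

(* Player i has strategy set S i and payoff function e i; dfwith s i s' is the
   profile s with its i-th component replaced by s'. *)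
Definition nash_min_equilibrium (R : realType) (I : eqType) (S : I -> Type)
    (e : I -> (forall i, S i) -> R) (s : forall i, S i) : Prop :=
  forall (i : I) (s' : S i), e i s <= e i (dfwith s i s').

Section possibility_theory.
Context {R : realType} {X : topologicalType}.
Hypothesis hX : hausdorff_space X.

Lemma closed_pt (x : X) : closed [set x].
Proof. exact/accessible_closed_set1/hausdorff_accessible. Qed.

Lemma possibility_supE (nu : set X -> R) (F : set X) :
  is_possibility nu -> closed F -> nu F = sup (density nu @` F).
Proof.
move=> nuP cF; have FE : \bigcup_(i : {x | F x}) [set sval i] = F.
  apply/seteqP; split => [x [[y Fy] _ /= ->]//|x Fx].
  by exists (exist _ x Fx).
rewrite -[in LHS]FE possibility_bigcup//; last 2 first.
- by move=> ?; exact: closed_pt.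
- by rewrite FE.
congr sup; apply/seteqP; split => [_ [[x Fx] _ <-]|_ [x Fx <-]].
  by exists x.
by exists (exist _ x Fx).
Qed.

Lemma possibility_eq (nu nu' : set X -> R) :
  is_possibility nu -> is_possibility nu' -> density nu =1 density nu' ->
  forall F, closed F -> nu F = nu' F.
Proof.
move=> h h' e F cF; rewrite !possibility_supE//; congr sup.
by apply/seteqP; split => _ [x Fx <-]; exists x.
Qed.

End possibility_theory.

Section usc.
Context {R : realType} {X : topologicalType}.

Let usc_on (K : set X) (g : X -> R) :=
  forall x, K x -> forall a, g x < a -> \forall y \near x, K y -> g y < a.

Lemma usc_max (K : set X) (g : X -> R) : compact K -> K !=set0 ->
  usc_on K g -> exists2 x, K x & forall y, K y -> g y <= g x.
Proof.
move=> cK [k Kk] ug.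
pose F := filter_from K (fun z => [set y | K y /\ g z <= g y]).
have PF : ProperFilter F.
  apply: filter_from_proper; last by move=> z Kz; exists z.
  apply: filter_from_filter; first by exists k.
  move=> i j Ki Kj; case: (leP (g i) (g j)) => ij.
    by exists j => // y [Ky jy]; split; split => //; exact: le_trans jy.
  exists i => // y [Ky iy]; split; split => //.
  exact: le_trans (ltW ij) iy.
have [x [Kx clx]] : K `&` cluster F !=set0.
  by apply: cK; exists k => // y [].
exists x => // z Kz; rewrite leNgt; apply/negP => xz.
have FA : F [set y | K y /\ g z <= g y] by exists z.
have [y [[Ky zy] /(_ Ky)]] := clx _ _ FA (ug x Kx _ xz).
by rewrite ltNge zy.
Qed.

Lemma tnorm_usc (T : R -> R -> R) (K : set X) (g h : X -> R) :
  continuous_tnorm T ->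
  (forall x, K x -> g x \in `[0, 1]) -> (forall x, K x -> h x \in `[0, 1]) ->
  usc_on K g -> usc_on K h -> usc_on K (fun x => T (g x) (h x)).
Proof.
move=> tT g01 h01 ug uh x Kx a Ta.
have /subspace_continuousP/(_ (g x, h x)) cT := tnorm_continuous tT.
have /cT {}cT : (`[0, 1]%classic `*` `[0, 1]%classic) (g x, h x).
  by split => /=; [exact: g01|exact: h01].
have Tn : nbhs (g x, h x) [set p : R * R |
    (`[0, 1]%classic `*` `[0, 1]%classic) p -> T p.1 p.2 < a].
  exact: (cvgr_lt _ cT _ Ta).
have [e /= e0 He] := (nbhs_ballP _ _).1 Tn.
have e20 : 0 < e / 2 by rewrite divr_gt0.
pose m (p : R) := Num.min 1 (p + e / 2).
have m01 (p : R) : p \in `[0, 1] -> m p \in `[0, 1].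
  rewrite !in_itv /= => /andP[p0 p1].
  by rewrite /m ge_min lexx le_min ler01 addr_ge0// ltW.
have mb (p : R) : p \in `[0, 1] -> ball p e (m p).
  rewrite in_itv /= => /andP[p0 p1]; rewrite -ball_normE /=.
  have pm : p <= m p by rewrite /m le_min p1 lerDl ltW.
  rewrite distrC ger0_norm ?subr_ge0// ltrBlDl.
  by rewrite /m gt_min ltrD2l [e / 2 < e]gtr_pMr// ?invf_lt1// ltr1n orbT.
have Hm : T (m (g x)) (m (h x)) < a.
  apply: (He (m (g x), m (h x))).
    by split => /=; apply: mb; [exact: g01|exact: h01].
  by split => /=; apply: m01; [exact: g01|exact: h01].
have gx : g x < g x + e / 2 by rewrite ltrDl.
have hx : h x < h x + e / 2 by rewrite ltrDl.
have := ug x Kx _ gx; have := uh x Kx _ hx.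
apply: filterS2 => y hy gy Ky.
apply: le_lt_trans Hm; apply: (tnorm_le tT).
- exact: g01.
- exact/m01/g01.
- exact: h01.
- exact/m01/h01.
- have := g01 _ Ky; rewrite in_itv /= => /andP[_ g1].
  by rewrite /m le_min g1 ltW// gy.
- have := h01 _ Ky; rewrite in_itv /= => /andP[_ h1].
  by rewrite /m le_min h1 ltW// hy.
Qed.

Lemma capacity_density_usc (nu : set X -> R) : hausdorff_space X ->
  is_capacity nu -> usc_on setT (density nu).
Proof.
move=> hX nuC x _ a xa.
have [ O [oO xO OB]] := capacity_usc nuC (closed_pt hX (x:=x)) xa.
have : nbhs x O by apply: open_nbhs_nbhs; split => //; exact: xO.
apply: filterS => y Oy _; apply: OB; first exact: closed_pt.
by move=> _ ->.
Qed.

End usc.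

Lemma tint_max (R : realType) (T : R -> R -> R) (X : topologicalType)
    (mu : set X -> R) (f : X -> R) :
  continuous_tnorm T -> compact [set: X] -> is_capacity mu -> continuous f ->
  exists2 t, t \in `[0, 1] & tint T mu f = T (mu (f @^-1` `[t, +oo[%classic)) t.
Proof.
move=> tT cX muC cf.
pose L t := f @^-1` `[t, +oo[%classic.
have cL t : closed (L t).
  by apply: closed_comp => [x _|]; [exact: cf|rewrite set_itvcy; exact: closed_ge].
have L01 t : mu (L t) \in `[0, 1] by exact: (capacity_itv muC).
have [] := @usc_max R R `[0, 1]%classic (fun t => T (mu (L t)) t).
- exact: segment_compact.
- by exists 0; rewrite /= in_itv /= lexx ler01.
- apply: tnorm_usc => //.
  + move=> s _ a sa; have [ O [oO LO OB]] := capacity_usc muC (cL s) sa.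
    have cO : compact (~` O).
      by apply: (subclosed_compact _ cX) => //; exact: open_closedC.
    have [[x Ox]|O0] := pselect ((~` O) !=set0); last first.
      apply: (@filterE _ (nbhs s)) => y _; apply: OB => // z _.
      by apply: contrapT => nOz; apply: O0; exists z.
    have [ | |y Oy ymax] := @usc_max R X (~` O) f cO.
    * by exists x.
    * by move=> z _ b zb; apply: filterS (cvgr_lt _ (cf z) _ zb) => w.
    have ys : f y < s.
      rewrite ltNge; apply/negP => sy; apply: Oy; apply: LO.
      by rewrite /L /= in_itv /= sy.
    have := lt_nbhsr ys; apply: filterS => t yt _; apply: OB => // z.
    rewrite /L /= in_itv /= andbT => tz; apply: contrapT => /ymax.
    by rewrite leNgt (lt_le_trans yt tz).
  + by move=> s _ a sa; have := lt_nbhsl sa; apply: filterS.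
move=> t t01 tmax; exists t => //; apply/eqP; rewrite eq_le; apply/andP; split.
  apply: ge_sup; first by exists (T (mu (L t)) t), t.
  by move=> _ [s s01 <-]; exact: tmax.
apply: ub_le_sup; last by exists t.
by exists (T (mu (L t)) t) => _ [s s01 <-]; exact: tmax.
Qed.

Section tensor_theory.
Context {R : realType} (T : R -> R -> R) (n : nat)
  (Z : 'I_n -> topologicalType).
Hypotheses (tT : continuous_tnorm T) (cZ : forall j, compact [set: Z j])
  (hZ : forall j, hausdorff_space (Z j)).
Variable nu : forall j, possibility R (Z j).

Let d : prod_topology Z -> R := tensor_density T nu.

Let nuC j : is_capacity (nu j) := possibility_is_capacity (possibilityP (nu j)).

Let one01 : (1 : R) \in `[0, 1].
Proof. by rewrite in_itv /= lexx ler01. Qed.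

Let nu01 j x : density (nu j) x \in `[0, 1].
Proof. by apply: (capacity_itv (nuC j)); exact: closed_pt. Qed.

Lemma tensor_density_itv z : d z \in `[0, 1].
Proof.
rewrite /d /tensor_density; elim/big_ind : _ => // x y; exact: (tnorm_itv tT).
Qed.

Let d01 z : 0 <= d z <= 1.
Proof. by have := tensor_density_itv z; rewrite in_itv. Qed.

Lemma tensor_density_usc z a : d z < a -> \forall y \near z, d y < a.
Proof.
pose g (s : seq 'I_n) (z : prod_topology Z) :=
  \big[T/1]_(j <- s) density (nu j) (z j).
have g01 s y : g s y \in `[0, 1].
  by rewrite /g; elim/big_ind : _ => // ? ?; exact: (tnorm_itv tT).
have gusc s : forall x, setT x -> forall a, g s x < a ->
    \forall y \near x, setT y -> g s y < a.
  elim: s => [|j s ih].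
    move=> x _ b xb; apply: (@filterE _ (nbhs x)) => y _.
    by move: xb; rewrite /g !big_nil.
  have -> : g (j :: s) = fun x => T (density (nu j) (x j)) (g s x).
    by apply/funext => x; rewrite /g big_cons.
  apply: tnorm_usc => // x _ b xb.
  have /(@proj_continuous _ Z j x) xjb :=
    capacity_density_usc (@hZ j) (nuC j) (x := x j) I xb.
  by apply: (@filterS _ (nbhs x) _ _ _ _ xjb) => y; exact.
move=> /(gusc (index_enum _) z I) gz.
by apply: (@filterS _ (nbhs z) _ _ _ _ gz) => y; exact.
Qed.

Let d_ub (F : set (prod_topology Z)) : has_ubound (d @` F).
Proof. by exists 1 => _ [z _ <-]; have /andP[] := d01 z. Qed.

Let tensor_ub F z : F z -> d z <= tensor T nu F.
Proof. by move=> Fz; apply: ub_le_sup; [exact: d_ub|exists z]. Qed.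

Let tensor_le F a : 0 <= a -> (forall z, F z -> d z <= a) -> tensor T nu F <= a.
Proof.
move=> a0 Fa; have [->|/set0P[z Fz]] := eqVneq F set0.
  by rewrite /tensor image_set0 sup0.
by apply: ge_sup => [|_ [y Fy <-]]; [exists (d z), z|exact: Fa].
Qed.

Let tensor_ge0 F : 0 <= tensor T nu F.
Proof.
have [->|/set0P[z Fz]] := eqVneq F set0.
  by rewrite /tensor image_set0 sup0.
by apply: le_trans (tensor_ub Fz); have /andP[] := d01 z.
Qed.

Lemma tensor_is_possibility : is_possibility (tensor T nu).
Proof.
have le1 F : tensor T nu F <= 1.
  by apply: tensor_le => // z _; have /andP[] := d01 z.
split; first split.
- by move=> F cF; rewrite in_itv /= tensor_ge0 le1.
- have pt j : exists x : Z j, density (nu j) x = 1.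
    have ZE := possibility_supE (@hZ j) (possibilityP (nu j)) closedT.
    rewrite (capacityT (nuC j)) in ZE.
    have [Z0|/set0P Z0] := eqVneq [set: Z j] set0.
      by move: ZE => /eqP; rewrite Z0 image_set0 sup0 oner_eq0.
    have [x _ xmax] := usc_max (@cZ j) Z0 (capacity_density_usc (@hZ j) (nuC j)).
    exists x; apply/eqP; rewrite eq_le.
    have := nu01 x; rewrite in_itv /= => /andP[_ ->] /=.
    rewrite ZE; apply: ge_sup; first by exists (density (nu j) x), x.
    by move=> _ [y _ <-]; exact: xmax.
  pose z : prod_topology Z := fun j => sval (cid (pt j)).
  apply/eqP; rewrite eq_le le1 /=; have <- : d z = 1.
    rewrite /d /tensor_density; elim/big_ind : _ => //.
      by move=> x y -> ->; exact: (tnormx1 tT).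
    by move=> j _; rewrite /z; case: cid.
  exact: tensor_ub.
- by rewrite /tensor image_set0 sup0.
- move=> F G _ _ FG; apply: tensor_le => // z Fz; apply: tensor_ub; exact: FG.
- move=> F a _ Fa; pose b := (tensor T nu F + a) / 2.
  have Fb : tensor T nu F < b by rewrite midf_lt.
  have ba : b < a by rewrite midf_lt.
  exists [set z | d z < b]; split.
  + rewrite openE => z /= zb; exact: tensor_density_usc.
  + by move=> z Fz /=; apply: le_lt_trans Fb; exact: tensor_ub.
  + move=> B _ Bb; apply: le_lt_trans ba; apply: tensor_le.
      by apply: le_trans (ltW Fb); exact: tensor_ge0.
    by move=> z Bz; apply: ltW; exact: Bb.
- move=> I A _ _.
  have Aub : has_ubound [set tensor T nu (A i) | i in [set: I]].
    by exists 1 => _ [i _ <-].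
  apply/eqP; rewrite eq_le; apply/andP; split.
    apply: tensor_le.
      have [i|noI] := pselect (exists i : I, True); last first.
        rewrite (_ : [set _ | _ in _] = set0) ?sup0//.
        by apply/seteqP; split => // x [i]; case: noI; exists i.
      have [i0 _] := i.
      apply: (le_trans (tensor_ge0 (A i0))).
      by apply: ub_le_sup => //; exists i0.
    move=> z [i _ Aiz]; apply: (le_trans (tensor_ub Aiz)).
    by apply: ub_le_sup => //; exists i.
  have [[i0 _]|noI] := pselect (exists i : I, True); last first.
    rewrite (_ : [set _ | _ in _] = set0) ?sup0//.
    by apply/seteqP; split => // x [i]; case: noI; exists i.
  apply: ge_sup; first by exists (tensor T nu (A i0)), i0.
  move=> _ [i _ <-]; apply: tensor_le => // z Az; apply: tensor_ub.
  by exists i.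
Qed.

Lemma density_tensor z : density (tensor T nu) z = tensor_density T nu z.
Proof. by rewrite /density /tensor image_set1 sup1. Qed.

End tensor_theory.

(* Main.v *)
(** Shrinking a density lowers every payoff, so against a given profile the
    best deviations of player [i] are Dirac capacities; an equilibrium is thus
    a profile of densities of maximum 1 in which no point [z] gives player [i]
    more than the worst case of any Dirac deviation. For finite
    [Z j] such a profile is found, up to [e], by letting the weight of a pure
    strategy increase as long as its worst case stays below every Dirac
    deviation's plus [e], and applying a discrete fixed point theorem on a grid
    of weights; a strategy of least worst case then has weight 1. The discrete
    theorem is Scarf's lemma on dominant sets for several linear orders, proved
    by a parity argument. In general, approximate equilibria on the finite
    subsets of the [Z j] are passed to the limit along an ultrafilter, the
    limit density being the upper semicontinuous envelope of the limits. *)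

From mathcomp Require Import all_boot all_order all_algebra.
From mathcomp Require Import zify.
Set Implicit Arguments.
Unset Strict Implicit.
Unset Printing Implicit Defensive.

(** * Scarf's lemma and a discrete fixed point theorem *)

Section Scarf.
Variables (T I : finType) (key : I -> T -> nat).
Hypothesis key_inj : forall i, injective (key i).
Implicit Types (S F : {set T}) (x y : T).

Definition dominant S := [forall y, exists i, forall x in S, key i y <= key i x].

Lemma dominantP S :
  reflect (forall y, exists i, forall x, x \in S -> key i y <= key i x)
          (dominant S).
Proof.
apply: (iffP forallP) => H y; have := H y.
  by case/existsP => i /forall_inP ?; exists i.
by case=> i ?; apply/existsP; exists i; apply/forall_inP.
Qed.

Lemma dominantS F S : F \subset S -> dominant S -> dominant F.
Proof.
move=> /subsetP FS /dominantP dS; apply/dominantP => y.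
by have [i Hi] := dS y; exists i => x /FS; exact: Hi.
Qed.

(** Sending each point of [S] to an order in which dominance makes it the minimum is injective,
    hence bijective by cardinality, so no point is the minimum for two orders. *)
Lemma dominant_min_inj S i j x : dominant S -> #|S| = #|I| -> x \in S ->
  (forall y, y \in S -> key i x <= key i y) ->
  (forall y, y \in S -> key j x <= key j y) -> i = j.
Proof.
move=> /dominantP dS cS xS xi xj.
have [f Hf] := fin_all_exists dS.
have f_inj : {in S &, injective f}.
  move=> a b aS bS ab; apply: (@key_inj (f a)); apply/eqP.
  by rewrite eqn_leq Hf// ab Hf.
have imf : f @: S = [set: I].
  by apply/eqP; rewrite eqEcard subsetT cardsT -cS card_in_imset/=.
have fS k : (forall y, y \in S -> key k x <= key k y) -> k = f x.
  move=> xk; have : k \in f @: S by rewrite imf.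
  case/imsetP => y yS kE; congr (_ = f _): (kE).
  by apply: (@key_inj k); apply/eqP; rewrite eqn_leq xk// andbT {1 2}kE Hf.
by rewrite (fS i xi) (fS j xj).
Qed.

(** The candidates for completing [F]: they exceed the minimum of [F] in all orders but [i], so
    dominance can only hold them down in order [i]. *)
Definition above F i : pred T :=
  fun y => [forall j, (j != i) ==> [exists s in F, key j s < key j y]].

Lemma aboveP F i y : reflect
  (forall j, j != i -> exists2 s, s \in F & key j s < key j y) (above F i y).
Proof.
apply: (iffP forallP) => H j; have := H j.
  by move=> /implyP + ji => /(_ ji) /exists_inP.
by move=> {}H; apply/implyP => /H ?; apply/exists_inP.
Qed.

Lemma dominant_above F i y : dominant F -> above F i y ->
  forall x, x \in F -> key i y <= key i x.
Proof.
move=> /dominantP/(_ y)[k Hk] /aboveP abv.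
have [<-//|ki] := eqVneq k i; have [s sF] := abv _ ki.
by rewrite ltnNge Hk.
Qed.

(* Exactly two indices [a] and [b] have the same minimum over [F]; the points
   completing [F] are the maxima of [above F a] for [key a] and of [above F b]
   for [key b]. *)
Lemma card_dominant_ext F x : #|F|.+1 = #|I| -> F != set0 ->
  (forall i, exists y, above F i y) -> x \notin F -> dominant (x |: F) ->
  #|[set y in ~: F | dominant (y |: F)]| = 2.
Proof.
move=> cF /set0Pn[s0 s0F] ab_ex xF dxF.
have dF : dominant F by apply: dominantS dxF; exact: subsetUr.
have cS y : y \notin F -> #|y |: F| = #|I| by move=> yF; rewrite cardsU1 yF.
(* [x] is the minimum of [x |: F] in order [a]. Once [x] is dropped, that role passes to [s], which
   already holds it in order [b]. *)
have [a Ha] := dominantP _ dxF x.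
pose s := [arg min_(s < s0 in F) key a s].
have [sF sa] : s \in F /\ forall y, y \in F -> key a s <= key a y.
  by rewrite /s; case: arg_minnP.
have [b Hb] := dominantP _ dxF s.
have sb y : y \in F -> key b s <= key b y by move=> yF; apply: Hb; rewrite setU1r.
have ab : a != b.
  apply/eqP => abE; move: xF; suff -> : x = s by rewrite sF.
  by apply: (@key_inj a); apply/eqP; rewrite eqn_leq Ha ?setU1r//= abE Hb ?setU11.
have max_above i : exists2 y, above F i y &
    forall z, above F i z -> key i z <= key i y.
  have [y0 ay0] := ab_ex i.
  exists [arg max_(y > y0 | above F i y) key i y]; first by case: arg_maxnP.
  by case: arg_maxnP.
have [xa xaA xaM] := max_above a; have [xb xbA xbM] := max_above b.
have notF i j y : i != j -> (forall z, z \in F -> key i s <= key i z) ->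
    (forall z, z \in F -> key j s <= key j z) -> above F i y -> y \notin F.
  move=> ij si sj yA; apply/negP => yF.
  have ys : y = s.
    by apply: (@key_inj i); apply/eqP; rewrite eqn_leq (dominant_above dF)//= si.
  move/aboveP: yA => /(_ j); rewrite eq_sym ij => /(_ isT)[z zF].
  by rewrite ys ltnNge sj.
(* A point of [above F i] is held down in order [i] by the maximality of [y]. Any other point is
   weakly below all of [F] in some order [j != i], where [y] exceeds a point of [F]. *)
have dom_max i y : above F i y ->
    (forall z, above F i z -> key i z <= key i y) -> dominant (y |: F).
  move=> yA yM; apply/dominantP => z.
  have [zA|/aboveP zA] := boolP (above F i z).
    exists i => w /setU1P[->|wF]; [exact: yM|exact: (dominant_above dF)].
  have [/existsP[j /andP[ji /forall_inP jz]]|/existsPn zF] :=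
      boolP [exists j, (j != i) && [forall w in F, key j z <= key j w]].
    exists j => w /setU1P[->|]; last exact: jz.
    have [t tF ty] := aboveP _ _ _ yA j ji.
    exact: leq_trans (jz t tF) (ltnW ty).
  case: zA => j ji; have := zF j; rewrite ji /= => /forall_inPn[w wF].
  by rewrite -ltnNge => wz; exists w.
have max_unique i y z : above F i y -> above F i z ->
    (forall t, above F i t -> key i t <= key i y) ->
    (forall t, above F i t -> key i t <= key i z) -> y = z.
  by move=> yA zA yM zM; apply: (@key_inj i); apply/eqP; rewrite eqn_leq zM// yM.
(* Conversely, a completion that is the minimum in order [i] is the maximum of [above F i]: by
   [dominant_min_inj] it is not the minimum in a second order. *)
have ext_above i y : y \notin F -> dominant (y |: F) ->
    (forall z, z \in F -> key i y <= key i z) ->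
    above F i y /\ forall z, above F i z -> key i z <= key i y.
  move=> yF dy yi; have yA : above F i y.
    apply/aboveP => j ji; apply/exists_inP; apply: contraT => /exists_inPn H.
    case/eqP: ji; apply/esym.
    apply: (dominant_min_inj dy (cS y yF) (setU11 _ _)) => z /setU1P[->|zF] //.
      exact: yi.
    by rewrite leqNgt H.
  split=> // z /aboveP zA; have [k Hk] := dominantP _ dy z.
  have [<-|ki] := eqVneq k i; first by rewrite Hk ?setU11.
  by have [t tF] := zA k ki; rewrite ltnNge Hk ?setU1r.
suff -> : [set y in ~: F | dominant (y |: F)] = [set xa; xb].
  rewrite cards2; case: eqVneq => // xab; exfalso.
  have [k Hk] := dominantP _ dF xa.
  have [ka|ka] := eqVneq k a.
    have := aboveP _ _ _ xbA k; rewrite ka => /(_ ab)[t tF].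
    by rewrite -xab -ka ltnNge Hk.
  by have [t tF] := aboveP _ _ _ xaA k ka; rewrite ltnNge Hk.
apply/setP => y; rewrite !inE; apply/andP/orP; last first.
  case=> /eqP ->; split; [exact: (notF a b)|exact: (dom_max a)| |exact: (dom_max b)].
  by apply: (notF b a) => //; rewrite eq_sym.
case=> yF dy.
have [/forall_inP ya|/forall_inPn[za zaF za_lt]] :=
    boolP [forall z in F, key a y <= key a z].
  have [yA yM] := ext_above a y yF dy ya.
  by left; apply/eqP; exact: (max_unique a).
have [/forall_inP yb|/forall_inPn[zb zbF zb_lt]] :=
    boolP [forall z in F, key b y <= key b z].
  have [yA yM] := ext_above b y yF dy yb.
  by right; apply/eqP; exact: (max_unique b).
(* Were [y] minimal in neither order, [s] would stay the minimum of [y |: F] in both [a] and [b]. *)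
exfalso; move/eqP: ab; apply.
apply: (dominant_min_inj dy (cS y yF) (setU1r _ sF)) => z /setU1P[->|zF].
- by rewrite -ltnNge in za_lt; apply: leq_trans (ltnW za_lt); exact: sa.
- exact: sa.
- by rewrite -ltnNge in zb_lt; apply: leq_trans (ltnW zb_lt); exact: sb.
- exact: sb.
Qed.

(** Both sides count the incidences of a set [S] with a facet [F = S :\ x]. *)
Lemma double_count_ext (A B : pred {set T}) :
  \sum_(F | A F) #|[set y in ~: F | B (y |: F)]| =
  \sum_(S | B S) #|[set x in S | A (S :\ x)]|.
Proof.
under eq_bigr do rewrite -sum1dep_card.
under [RHS]eq_bigr do rewrite -sum1dep_card.
rewrite (exchange_big_dep xpredT)//= [RHS](exchange_big_dep xpredT)//=.
apply: eq_bigr => x _.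
rewrite (reindex_onto (fun S => S :\ x) (fun F => x |: F)) /=; last first.
  by move=> F /and3P[_ + _]; rewrite inE => /setU1K.
apply: eq_bigl => S; rewrite !inE eqxx /=.
have [xS|xS] := boolP (x \in S).
  by rewrite setD1K// eqxx andbT andbC.
rewrite andbF; apply/negP => /andP[_ /eqP SE].
by move: xS; rewrite -SE setU11.
Qed.

(** The slack points play the corners of the simplex in Sperner's lemma; [t0] ensures that other
    points exist. *)
Variables (slack : I -> T) (col : T -> I) (t0 : T).
Hypothesis slack_min : forall i x, key i (slack i) <= key i x.
Hypothesis slack_max : forall i j t,
  t \notin codom slack -> i != j -> key j t < key j (slack i).
Hypothesis t0_notin : t0 \notin codom slack.
Hypothesis col_slack : cancel slack col.
Hypothesis cardI : 1 < #|I|.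

Lemma even_rainbow_facets i0 S : #|S| = #|I| -> col @: S != [set: I] ->
  ~~ odd #|[set x in S |
    (#|S :\ x|.+1 == #|I|) && (col @: (S :\ x) == [set~ i0])]|.
Proof.
move=> cS; apply: contraR => /negPn odd_facets.
have [x0] : exists x, x \in [set x in S |
    (#|S :\ x|.+1 == #|I|) && (col @: (S :\ x) == [set~ i0])].
  by apply/set0Pn; apply: contraTneq odd_facets => ->; rewrite cards0.
have injS x : col @: (S :\ x) = [set~ i0] -> #|S :\ x|.+1 = #|I| ->
    {in S :\ x &, injective col}.
  by move=> imx cx; apply/imset_injP; rewrite imx cardsC1 -cx.
rewrite inE => /and3P[x0S /eqP cx0 /eqP im0].
have [ci0|ci0] := eqVneq (col x0) i0.
  by rewrite -(setD1K x0S) imsetU1 ci0 im0 setUCr.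
have : col x0 \in col @: (S :\ x0) by rewrite im0 !inE.
case/imsetP => x1 /setD1P[x10 x1S] cx01.
exfalso; move: odd_facets.
suff -> : [set x in S |
    (#|S :\ x|.+1 == #|I|) && (col @: (S :\ x) == [set~ i0])] = [set x0; x1].
  by rewrite cards2 eq_sym x10.
apply/setP => x; rewrite !inE; apply/and3P/orP.
  case=> xS /eqP cx /eqP imx.
  have [|nx0] := eqVneq x x0; first by left.
  have [|nx1] := eqVneq x x1; first by right.
  move/eqP: x10; case; by apply: (injS x) => //; rewrite !inE eq_sym ?nx0 ?nx1.
case=> /eqP -> //; first by split=> //; apply/eqP.
split=> //; first by rewrite -cS (cardsD1 x1 S) x1S.
have dropS y z : y \in S -> z \in S :\ y -> col y = col z ->
    col @: (S :\ y) = col @: S.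
  move=> yS zSy yz; rewrite -{2}(setD1K yS) imsetU1; apply/esym/setUidPr.
  by rewrite sub1set yz imset_f.
rewrite -im0 (dropS x1 x0) ?(dropS x0 x1) //; last by rewrite !inE x0S eq_sym x10.
by rewrite !inE x1S x10.
Qed.

(* Both sides of [double_count_ext] count the facets coloured [set~ i0]: the
   facet of slack points has one completion, every other facet has none or two,
   and a dominant set that is not rainbow contains none or two. *)
Lemma exists_rainbow_dominant : exists S, dominant S /\ col @: S = [set: I].
Proof.
have [i0 _] : exists i0, i0 \in I by apply/card_gt0P/ltnW.
have [/existsP[S /andP[dS /eqP cS]]|/existsPn rainbowN] :=
  boolP [exists S, dominant S && (col @: S == [set: I])]; first by exists S.
exfalso.
pose A F := (#|F|.+1 == #|I|) && (col @: F == [set~ i0]).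
pose B S := (#|S| == #|I|) && dominant S.
have even_sum (P : pred {set T}) (f : {set T} -> nat) :
    (forall S, P S -> ~~ odd (f S)) -> ~~ odd (\sum_(S | P S) f S).
  move=> Pf; apply: (big_ind (fun m => ~~ odd m)) => // m n.
  by rewrite oddD => /negPf -> /negPf ->.
have := even_sum B (fun S => #|[set x in S | A (S :\ x)]|).
rewrite -double_count_ext => /(_ _)/negP; apply.
  move=> S /andP[/eqP cS dS]; apply: even_rainbow_facets => //.
  by have := rainbowN S; rewrite dS.
pose F0 := slack @: [set~ i0].
have slack_inj : injective slack := can_inj col_slack.
have AF0 : A F0.
  rewrite /A card_imset// cardsC1 prednK ?(ltnW cardI)// eqxx /=.
  rewrite -imset_comp (eq_imset (g := id)) ?imset_id//.
rewrite (bigD1 F0)//= oddD (negPf (even_sum _ _ _)) ?addbF.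
  have imF0 x : (x \in F0) = (x \in codom slack) && (x != slack i0).
    apply/imsetP/andP => [[i + ->]|[/codomP[i ->]]].
      by rewrite !inE (inj_eq slack_inj) codom_f.
    by rewrite (inj_eq slack_inj) => ii0; exists i; rewrite ?inE.
  (* Only the non-slack point greatest in order [i0] completes [F0]; [slack i0] fails because [t0]
     would exceed the minimum in every order. *)
  pose tm := [arg max_(t > t0 | t \notin codom slack) key i0 t].
  have [tmN tmM] : tm \notin codom slack /\
      forall t, t \notin codom slack -> key i0 t <= key i0 tm.
    by rewrite /tm; case: arg_maxnP.
  have cF0 : #|F0|.+1 = #|I| by apply/eqP; case/andP: AF0.
  rewrite (_ : [set _ in _ | _] = [set tm]) ?cards1//.
  apply/setP => y; rewrite !inE /B cardsU1.
  have [yF0|yF0] /= := boolP (y \in F0).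
    apply/esym/negbTE; apply: contraTneq yF0 => ->.
    by rewrite imF0 (negPf tmN).
  rewrite add1n cF0 eqxx /=; apply/dominantP/eqP => [dy|->{y yF0} z].
    have dy_nonslack t : t \notin codom slack -> key i0 t <= key i0 y.
      move=> tN; have [i Hi] := dy t; have [<-|ii0] := eqVneq i i0.
        exact/Hi/setU11.
      suff : key i t <= key i (slack i).
        move=> /(conj (slack_min i t))/andP; rewrite -eqn_leq => /eqP/key_inj tE.
        by rewrite -tE codom_f in tN.
      by apply: Hi; rewrite setU1r// imF0 codom_f (inj_eq slack_inj).
    have yN : y \notin codom slack.
      apply: contra yF0 => ys; rewrite imF0 ys; apply/eqP => yE.
      have := dy_nonslack t0 t0_notin; rewrite yE.
      move=> /(conj (slack_min i0 t0))/andP; rewrite -eqn_leq => /eqP/key_inj tE.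
      by move: t0_notin; rewrite -tE codom_f.
    by apply: (@key_inj i0); apply/eqP; rewrite eqn_leq tmM// dy_nonslack.
  have [/codomP[i ->]|zN] := boolP (z \in codom slack); first by exists i.
  exists i0 => x /setU1P[->|]; first exact: tmM.
  rewrite imF0 => /andP[/codomP[i ->]]; rewrite (inj_eq slack_inj) => ii0.
  exact/ltnW/slack_max.
move=> F /andP[/andP[/eqP cF /eqP imF] FF0].
have [->|/set0Pn[x]] := eqVneq [set y in ~: F | B (y |: F)] set0.
  by rewrite cards0.
rewrite !inE => /and3P[xF cxF dxF].
rewrite (_ : [set _ in _ | _] = [set y in ~: F | dominant (y |: F)]); last first.
  apply/setP => y; rewrite !inE /B cardsU1.
  by case: (y \in F) => //=; rewrite add1n cF eqxx.
rewrite (card_dominant_ext _ _ _ xF)//.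
  by rewrite -card_gt0 -ltnS cF.
(* A facet made of slack points would be [F0]. A non-slack point [t] of [F] puts each [slack i] in
   [above F i]. *)
have [t tF ts] : exists2 t, t \in F & t \notin codom slack.
  apply/exists_inP; apply: contraNT FF0 => /exists_inPn Fs.
  rewrite /F0 -imF -imset_comp [X in _ == X](eq_in_imset (g := id)) ?imset_id//.
  by move=> t /Fs /negPn/codomP[i ->] /=; rewrite col_slack.
move=> i; exists (slack i); apply/aboveP => j ji.
by exists t => //; apply: slack_max; rewrite // eq_sym.
Qed.
End Scarf.

(** * A discrete fixed point theorem on a grid, from Scarf's lemma *)

Section Grid.
Variables (C : finType) (M : nat).
Local Notation grid := {ffun C -> 'I_M.+1}.
Variable P : C -> pred grid.
Hypothesis cardC : 0 < #|C|.

Let L := #|C| * M + M.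
Let B := #|{: grid}|.

(* The additional order [None] prefers points of small sum; [key] breaks ties
   between levels by [enum_rank]. *)
Let level (i : option C) (p : grid) : nat :=
  if i is Some c then p c else #|C| * M - \sum_c p c.

Let key (i : option C) (t : option C + grid) : nat :=
  match t with
  | inl j => if j == i then 0 else (L.+1 * B).+1 + enum_rank j
  | inr p => (level i p * B + enum_rank p).+1
  end.

(** With [P c p] read as a request to increase coordinate [c], a grid point is coloured [None] when
    no request can be met. *)
Let colour (t : option C + grid) : option C :=
  match t with
  | inl j => j
  | inr p => [pick c | P c p && (p c < M)]
  end.

Let sum_le (p : grid) : \sum_c p c <= #|C| * M.
Proof.
rewrite -sum_nat_const; apply: leq_sum => c _; exact: leq_ord.
Qed.

Let key_lt i p : key i (inr p) < (L.+1 * B).+1.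
Proof.
rewrite /key ltnS mulSn [B + _]addnC -addnS; apply: leq_add; last first.
  exact: ltn_ord.
rewrite leq_mul2r; apply/orP; right; rewrite /L /level.
case: i => [c|]; last by lia.
by rewrite (leq_trans (leq_ord (p c)))// leq_addl.
Qed.

Let level_le i p q : key i (inr p) <= key i (inr q) -> level i p <= level i q.
Proof.
rewrite /key ltnS => le; have B0 : 0 < B by apply/card_gt0P; exists p.
have -> : level i p = (level i p * B + enum_rank p) %/ B.
  by rewrite divnMDl// divn_small ?addn0//; exact: ltn_ord.
have -> : level i q = (level i q * B + enum_rank q) %/ B.
  by rewrite divnMDl// divn_small ?addn0//; exact: ltn_ord.
exact: leq_div2r.
Qed.

Let key_inj i : injective (key i).
Proof.
move=> [j|p] [k|q]; last 1 first.
- move=> pq; congr inr; have lpq : level i p = level i q.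
    by apply/eqP; rewrite eqn_leq !level_le ?pq.
  move: pq => [] /eqP; rewrite lpq eqn_add2l => /eqP/val_inj.
  exact: enum_rank_inj.
- rewrite /key; case: eqVneq => [->|ji]; case: eqVneq => [->|ki] // [].
  by move=> /eqP; rewrite eqn_add2l => /eqP/val_inj/enum_rank_inj ->.
- have := key_lt i q; rewrite /key; case: eqP => // _; lia.
- have := key_lt i p; rewrite /key; case: eqP => // _; lia.
Qed.

(** [p] is the point coloured [None] in a rainbow dominant set [S], whose grid points are within
    [#|C|] of each other in each coordinate. The point coloured [Some c] is the neighbour [q],
    unless it is a slack point, which forces [p c <= #|C|]. *)
Lemma grid_fixed_point : exists p : grid,
  (forall c, p c = M :> nat \/ ~~ P c p) /\
  forall c, p c <= #|C| \/ exists q : grid, P c q /\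
    forall d, p d <= q d + #|C| /\ q d <= p d + #|C|.
Proof.
have slackN (p : grid) : inr p \notin codom (inl : option C -> option C + grid).
  by apply/codomP => -[].
have [] := @exists_rainbow_dominant _ _ key key_inj inl colour (inr [ffun=> ord0]).
- by move=> i x; rewrite /key eqxx.
- move=> i j [k|p]; first by rewrite codom_f.
  move=> _ ij; apply: leq_trans (key_lt j p) _.
  by rewrite /key (negPf ij) leq_addr.
- exact: slackN.
- by move=> j.
- by rewrite card_option ltnS.
move=> S [/dominantP dS cS].
(* [v] is one more than the least coordinate [c] over [S], or zero if the slack point of [c] is in
   [S]. It fits in the grid because the point coloured [Some c] has that coordinate below [M]. *)
have facetc c : exists v : 'I_M.+1,
    [/\ inl (Some c) \in S -> v = 0 :> nat,
        forall p, inr p \in S -> v <= (p c).+1 &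
        inl (Some c) \notin S -> (exists2 q, inr q \in S & P c q) /\
          exists2 q : grid, inr q \in S & v = (q c).+1 :> nat].
  have [cinS|cN] := boolP (inl (Some c) \in S); first by exists ord0.
  have : Some c \in colour @: S by rewrite cS.
  case/imsetP => -[j|q] qS /= qE; first by rewrite qE qS in cN.
  have [Pq qM] : P c q /\ q c < M.
    by move: qE; case: pickP => // d /andP[Pd dM] [->].
  pose m := [arg min_(p < q | inr p \in S) p c].
  have [mS mmin] : inr m \in S /\ forall p, inr p \in S -> m c <= p c.
    by rewrite /m; case: arg_minnP.
  have mM : (m c).+1 < M.+1 by rewrite ltnS (leq_ltn_trans (mmin _ qS)).
  exists (Ordinal mM); split=> //= _; split; by [exists q|exists m].
(* [v] beats [S] in every order but [None], so by dominance no point of [S] has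
   a larger sum than [v]. *)
have [v Hv] := fin_all_exists facetc.
pose y : grid := finfun v.
have yE c : y c = v c by rewrite ffunE.
have [i Hi] := dS (inr y).
have [iE NoneN] : i = None /\ inl None \notin S.
  have iN : inl i \notin S by apply/negP => /Hi; rewrite /key eqxx.
  case: i Hi iN => // c Hi cN; exfalso.
  have [_ _ /(_ cN)[_ [q qS vE]]] := Hv c.
  by have /level_le := Hi _ qS; rewrite /= yE vE ltnn.
rewrite {}iE in Hi.
have sum_leS p : inr p \in S -> \sum_c p c <= \sum_c y c.
  by move=> /Hi/level_le /=; rewrite leq_subCl subKn ?sum_le.
have yp p c : inr p \in S -> y c <= (p c).+1.
  by move=> pS; have [_ + _] := Hv c; rewrite yE; exact.
(* The sum of [p] is at most that of [y], and the other [#|C| - 1] coordinates of [y] exceed those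
   of [p] by at most one each. *)
have py p c : inr p \in S -> p c < y c + #|C|.
  move=> pS; have := sum_leS p pS; rewrite (bigD1 c)//= [X in _ <= X](bigD1 c)//=.
  have : \sum_(d | d != c) y d <= \sum_(d | d != c) (p d + 1).
    by apply: leq_sum => d _; rewrite addn1; exact: yp.
  rewrite big_split sum1_card cardC1 /=.
  move: (\sum_(d | d != c) y d) (\sum_(d | d != c) p d) => a b.
  have := cardC; move: #|C| => N; lia.
have : None \in colour @: S by rewrite cS.
case/imsetP => -[j|p] pS /= pE; first by rewrite pE pS in NoneN.
exists p; split=> c.
  move: pE; case: pickP => // /(_ c) + _.
  case: (P c p) => /=; last by right.
  by move=> /negbT; rewrite -leqNgt => Mp; left; apply/eqP; rewrite eqn_leq leq_ord.
have [cinS|cN] := boolP (inl (Some c) \in S).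
  left; have [/(_ cinS) v0 _ _] := Hv c.
  by have := py p c pS; rewrite yE v0 add0n => /ltnW.
right; have [_ _ /(_ cN)[[q qS Pq] _]] := Hv c.
exists q; split=> // d.
have := py p d pS; have := py q d qS; have := yp p d pS; have := yp q d qS; have := cardC.
by move: #|C| (p d : nat) (q d : nat) (y d : nat) => N a b e; lia.
Qed.
End Grid.

Require Import Defs.
From mathcomp Require Import all_classical all_reals all_analysis.
From mathcomp Require Import lra.
Import Order.TTheory GRing.Theory Num.Theory.
Import numFieldNormedType.Exports.
Local Open Scope classical_set_scope.
Local Open Scope ring_scope.

(** * Uniform continuity of triangular norms *)

Section TNorm.
Context {R : realType}.
Implicit Types (T : R -> R -> R).

Lemma mem01 (x : R) : (x \in `[0, 1]) = (0 <= x <= 1).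
Proof. by rewrite in_itv. Qed.

Lemma one_mem01 : (1 : R) \in `[0, 1].
Proof. by rewrite mem01 ler01 lexx. Qed.

Lemma zero_mem01 : (0 : R) \in `[0, 1].
Proof. by rewrite mem01 ler01 lexx. Qed.

Lemma tnorm_le_l T x y : continuous_tnorm T -> x \in `[0, 1] -> y \in `[0, 1] ->
  T x y <= x.
Proof.
move=> tT x01 y01; rewrite -[leRHS](tnormx1 tT)//.
apply: (tnorm_le tT) => //; first exact: one_mem01.
by move: y01; rewrite mem01 => /andP[].
Qed.

Lemma tnorm_le_r T x y : continuous_tnorm T -> x \in `[0, 1] -> y \in `[0, 1] ->
  T x y <= y.
Proof. by move=> tT x01 y01; rewrite (tnormC tT)//; exact: tnorm_le_l. Qed.

Lemma big_tnorm01 T (I : Type) (r : seq I) (a : I -> R) : continuous_tnorm T ->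
  (forall j, a j \in `[0, 1]) -> \big[T/1]_(j <- r) a j \in `[0, 1].
Proof.
move=> tT a01; elim/big_ind : _ => //; first exact: one_mem01.
by move=> x y; exact: (tnorm_itv tT).
Qed.

Lemma big_tnorm_le T (I : eqType) (r : seq I) (a : I -> R) j :
  continuous_tnorm T -> (forall j, a j \in `[0, 1]) -> j \in r ->
  \big[T/1]_(j <- r) a j <= a j.
Proof.
move=> tT a01; elim: r => // k r ih.
have r01 := big_tnorm01 r tT a01.
rewrite inE big_cons => /orP[/eqP ->|/ih jr]; first exact: tnorm_le_l.
by apply: le_trans jr; exact: tnorm_le_r.
Qed.

(** Compactness of the unit square makes [T] uniformly continuous; monotonicity allows one-sided
    hypotheses, by passing from [x] to [Num.max x x'], which is close to [x']. *)
Lemma tnorm_ucont T : continuous_tnorm T -> forall e, 0 < e -> exists2 d, 0 < d &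
  forall x x' y y', x \in `[0, 1] -> x' \in `[0, 1] ->
    y \in `[0, 1] -> y' \in `[0, 1] ->
    x <= x' + d -> y <= y' + d -> T x y <= T x' y' + e.
Proof.
move=> tT e e0.
pose K : set (R * R) := `[0, 1]%classic `*` `[0, 1]%classic.
have cK : compact K by apply: compact_setX; exact: segment_compact.
pose Q (d : R) (p : R * R) := forall q, K q -> ball p d q -> T q.1 q.2 < T p.1 p.2 + e.
have : \forall d \near 0^'+, K `<=` Q d.
  have cK' : near_covering_within K.
    by apply/near_covering_withinP/compact_near_coveringP.
  apply: (cK' R 0^'+ Q _).
  move=> p Kp; have /subspace_continuousP/(_ p Kp) cT := tnorm_continuous tT.
  have Tp : nbhs p [set q | K q -> T q.1 q.2 < T p.1 p.2 + e / 2 /\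
      T p.1 p.2 - e / 2 < T q.1 q.2].
    have h1 : T p.1 p.2 < T p.1 p.2 + e / 2 by lra.
    have h2 : T p.1 p.2 - e / 2 < T p.1 p.2 by lra.
    have n1 : nbhs p [set q | K q -> T q.1 q.2 < T p.1 p.2 + e / 2].
      exact: (cvgr_lt _ cT _ h1).
    have n2 : nbhs p [set q | K q -> T p.1 p.2 - e / 2 < T q.1 q.2].
      exact: (cvgr_gt _ cT _ h2).
    by apply: filterS2 n1 n2 => q q1 q2 Kq; split; [exact: q1|exact: q2].
  have [r /= r0 Hr] := (nbhs_ballP _ _).1 Tp.
  have r20 : 0 < r / 2 by rewrite divr_gt0.
  exists (ball p (r / 2), [set d : R | d < r / 2]) => /=.
    split; first exact: nbhsx_ballx.
    exact: nbhs_right_lt.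
  move=> [p' d] /= [pp' dr] Kp' q Kq p'q.
  have [//|_ Tp'] := Hr p' _ Kp'; first by apply: le_ball pp'; lra.
  have [|Tq _] := Hr q _ Kq.
    rewrite [r]splitr; apply: ball_triangle pp' _.
    by apply: le_ball p'q; exact: ltW.
  lra.
move=> near_d; have [d [d0 Hd]] : exists d : R, 0 < d /\ K `<=` Q d.
  near (0 : R)^'+ => d; exists d; split => //; near: d.
  exact: near_d.
exists (d / 2); first by rewrite divr_gt0.
move=> x x' y y' x01 x'01 y01 y'01 xx' yy'.
have max01 (a b : R) : a \in `[0, 1] -> b \in `[0, 1] -> Num.max a b \in `[0, 1].
  by move=> a01 b01; case: leP.
have ball_max (a b : R) : a <= b + d / 2 -> ball b d (Num.max a b).
  move=> ab; rewrite -ball_normE /= ltr_norml.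
  by have [|] := leP a b => ?; apply/andP; split; lra.
apply: (@le_trans _ _ (T (Num.max x x') (Num.max y y'))).
  by apply: (tnorm_le tT); rewrite ?max01// le_max lexx.
apply/ltW; apply: (Hd (x', y') _ (Num.max x x', Num.max y y')); split => //=;
  do ?[exact: max01|exact: ball_max].
Unshelve. all: by end_near. Qed.

Lemma big_tnorm_ucont T (I : Type) (r : seq I) : continuous_tnorm T ->
  forall e, 0 < e -> exists2 d, 0 < d & forall a b : I -> R,
    (forall j, a j \in `[0, 1]) -> (forall j, b j \in `[0, 1]) ->
    (forall j, a j <= b j + d) ->
    \big[T/1]_(j <- r) a j <= \big[T/1]_(j <- r) b j + e.
Proof.
move=> tT; elim: r => [|j r ih] e e0.
  by exists 1 => // a b _ _ _; rewrite !big_nil lerDl ltW.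
have [d d0 Hd] := tnorm_ucont tT e0; have [d' d'0 Hd'] := ih _ d0.
exists (Num.min d d'); first by rewrite lt_min d0.
move=> a b a01 b01 ab; rewrite !big_cons; apply: Hd => //.
- exact: big_tnorm01.
- exact: big_tnorm01.
- by apply: le_trans (ab j) _; rewrite lerD2l ge_min lexx.
- by apply: Hd' => // k; apply: le_trans (ab k) _; rewrite lerD2l ge_min lexx orbT.
Qed.

End TNorm.

(** * Approximate equilibria of finite games *)

Section Value.
Context {R : realType} (star ast : R -> R -> R) (n : nat).
Hypotheses (star_tnorm : continuous_tnorm star) (ast_tnorm : continuous_tnorm ast).
Implicit Types (a b : 'I_n -> R) (t s : R).

(** With [a] the densities at a point [z] and [t = u i z], these are the terms whose supremum over
    [z] is the payoff of player [i]. *)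
Definition value a t : R := star (\big[ast/1]_(j < n) a j) t.

Lemma value_itv a t : (forall j, a j \in `[0, 1]) -> t \in `[0, 1] ->
  value a t \in `[0, 1].
Proof. by move=> a01 t01; apply: (tnorm_itv star_tnorm) => //; exact: big_tnorm01. Qed.

Lemma value_le_coord a t j : (forall j, a j \in `[0, 1]) -> t \in `[0, 1] ->
  value a t <= a j.
Proof.
move=> a01 t01; apply: le_trans (tnorm_le_l star_tnorm _ t01) _.
  exact: big_tnorm01.
by apply: big_tnorm_le => //; exact: mem_index_enum.
Qed.

Lemma value_ucont e : 0 < e -> exists2 d, 0 < d & forall a b t s,
  (forall j, a j \in `[0, 1]) -> (forall j, b j \in `[0, 1]) ->
  t \in `[0, 1] -> s \in `[0, 1] ->
  (forall j, a j <= b j + d) -> t <= s + d -> value a t <= value b s + e.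
Proof.
move=> e0; have [d d0 Hd] := tnorm_ucont star_tnorm e0.
have [d' d'0 Hd'] := big_tnorm_ucont (index_enum 'I_n) ast_tnorm d0.
exists (Num.min d d'); first by rewrite lt_min d0.
move=> a b t s a01 b01 t01 s01 ab ts; apply: Hd => //; try exact: big_tnorm01.
  by apply: Hd' => // j; apply: le_trans (ab j) _; rewrite lerD2l ge_min lexx orbT.
by apply: le_trans ts _; rewrite lerD2l ge_min lexx.
Qed.

Lemma value_le a b t : (forall j, a j \in `[0, 1]) -> (forall j, b j \in `[0, 1]) ->
  t \in `[0, 1] -> (forall j, a j <= b j) -> value a t <= value b t.
Proof.
move=> a01 b01 t01 ab; apply/ler_addgt0Pr => e e0.
have [d d0] := value_ucont e0; apply=> // [j|]; last by rewrite lerDl ltW.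
by rewrite (le_trans (ab j))// lerDl ltW.
Qed.

End Value.

Section FiniteGame.
Context {R : realType} (star ast : R -> R -> R) (n : nat).
Hypotheses (star_tnorm : continuous_tnorm star) (ast_tnorm : continuous_tnorm ast).
Variables (K : 'I_n -> finType) (u : 'I_n -> (forall j, K j) -> R).
Hypotheses (n_gt0 : (0 < n)%N) (u_itv : forall i z, u i z \in `[0, 1]).
Hypothesis K_inhabited : forall j, K j.

Local Notation value := (value star ast).

Let dirac_at (i : 'I_n) (w : forall j, K j -> R) (z : forall j, K j) j : R :=
  if j == i then 1 else w j (z j).

(** A Dirac deviation [x] of player [i] is worth the best value over the [z'] with [z' i = x], with
    weight 1 in coordinate [i]; the last property says that no [z] beats it by more than [e]. *)
Lemma finite_game e : 0 < e -> exists w : forall j, K j -> R,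
  [/\ forall j k, w j k \in `[0, 1], forall j, exists k, w j k = 1 &
  forall i x z, exists2 z' : forall j, K j, z' i = x &
    value (fun j => w j (z j)) (u i z)
    <= value (fun j => if j == i then 1 else w j (z' j)) (u i z') + e].
Proof.
move=> e0; have e40 : 0 < e / 4 by rewrite divr_gt0.
have [d d0 Hd] := value_ucont n star_tnorm ast_tnorm e40.
pose C := {j : 'I_n & K j} : finType.
(* [#|C| / M] will be at most [d], so that neighbouring grid points have close values, and at most
   [e], so that a weight of [#|C|] steps is negligible. *)
pose d' := Num.min d e; have d'0 : 0 < d' by rewrite lt_min d0.
have C0 : (0 < #|C|)%N.
  by apply/card_gt0P; exists (Tagged K (K_inhabited (Ordinal n_gt0))).
pose M := Num.bound (#|C|%:R / d').
have M_large : #|C|%:R / M%:R <= d' /\ (0 < M)%N.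
  have := archi_boundP (ltW (divr_gt0 (_ : 0 < #|C|%:R :> R) d'0)).
  rewrite ltr0n => /(_ C0); rewrite -/M => CM.
  have M0 : 0 < M%:R :> R by apply: lt_trans CM; rewrite divr_gt0// ltr0n.
  by rewrite ler_pdivrMr// mulrC -ler_pdivrMr// ltW// -(ltr0n R).
have [CMd M0] := M_large; have M0R : 0 < M%:R :> R by rewrite ltr0n.
pose W (p : {ffun C -> 'I_M.+1}) j (k : K j) : R := (p (Tagged K k))%:R / M%:R.
have W01 p j k : W p j k \in `[0, 1].
  rewrite mem01 divr_ge0//= ler_pdivrMr// mul1r ler_nat; exact: leq_ord.
have D01 i p z j : dirac_at i (W p) z j \in `[0, 1].
  by rewrite /dirac_at; case: ifP => // _; exact: one_mem01.
(* The margin [e / 2] leaves [e / 4] for each of the two passages between [p] and its neighbour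
   [q]. *)
pose wants (c : C) (p : {ffun C -> 'I_M.+1}) : bool := `[< forall z : forall j, K j,
  z (tag c) = tagged c -> forall x, exists2 z' : forall j, K j, z' (tag c) = x &
  value (fun j => W p j (z j)) (u (tag c) z)
    < value (dirac_at (tag c) (W p) z') (u (tag c) z') + e / 2 >].
have [p [pM pN]] := grid_fixed_point wants C0.
exists (W p); split => // [i|i x z].
- have [/existsP[k /eqP pk]|/existsPn noM] :=
    boolP [exists k : K i, nat_of_ord (p (Tagged K k)) == M].
    by exists k; rewrite /W pk divff// gt_eqF.
  exfalso.
  have bad (k : K i) : exists z : forall j, K j, z i = k /\
      exists x, forall z' : forall j, K j, z' i = x ->
      value (dirac_at i (W p) z') (u i z') + e / 2
      <= value (fun j => W p j (z j)) (u i z).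
    have [/eqP|] := pM (Tagged K k); first by rewrite (negPf (noM k)).
    move=> /asboolPn /existsNP[z /not_implyP[/= zk /existsNP[x Hx]]].
    exists z; split => //; exists x => z' z'x; rewrite leNgt; apply/negP => lt.
    by apply: Hx; exists z'.
  have [f Hf] := choice bad.
  pose g k := value (dirac_at i (W p) (f k)) (u i (f k)).
  (* For [k] of least [g], the deviation [x] that fails gives [g x + e / 2 <= g k <= g x]. *)
  have [k kmin] : exists k, forall k', g k <= g k'.
    exists [arg min_(k < K_inhabited i) g k]%O.
    by case: arg_minP => // k _ kmin k'; exact: kmin.
  have [_ [x Hx]] := Hf k; have [fx _] := Hf x.
  have : value (fun j => W p j (f k j)) (u i (f k)) <= g k.
    apply: value_le => // j; rewrite /dirac_at; case: ifP => // _.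
    by have := W01 p j (f k j); rewrite mem01 => /andP[].
  move=> /(le_trans (Hx _ fx)); have := kmin x; rewrite /g; lra.
- pose c : C := Tagged K (z i).
  have Wle (q r : {ffun C -> 'I_M.+1}) j (k : K j) :
      (q (Tagged K k) <= r (Tagged K k) + #|C|)%N ->
      W q j k <= W r j k + d.
    move=> qr; apply: (@le_trans _ _ (W r j k + #|C|%:R / M%:R)).
      by rewrite /W -mulrDl ler_pM2r ?invr_gt0// -natrD ler_nat.
    by rewrite lerD2l (le_trans CMd)// ge_min lexx.
  have [pc|[q [/asboolP Pq qp]]] := pN c.
    exists (dfwith z i x); first by rewrite dfwithin.
    apply: (@le_trans _ _ (W p i (z i))).
      exact: (value_le_coord star_tnorm ast_tnorm i).
    apply: (@le_trans _ _ e); last first.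
      rewrite lerDr; have := value_itv star_tnorm ast_tnorm (D01 i p (dfwith z i x))
        (u_itv i (dfwith z i x)).
      by rewrite mem01 => /andP[].
    apply: (@le_trans _ _ d'); last by rewrite ge_min lexx orbT.
    by apply: le_trans CMd; rewrite ler_pM2r ?invr_gt0// ler_nat.
  have [z' z'x] := Pq z erefl x; rewrite /= => lt.
  exists z' => //.
  have le1 : value (fun j => W p j (z j)) (u i z)
      <= value (fun j => W q j (z j)) (u i z) + e / 4.
    apply: Hd => // [j|]; last by rewrite lerDl ltW.
    by apply: Wle; have [] := qp (Tagged K (z j)).
  have le2 : value (dirac_at i (W q) z') (u i z')
      <= value (dirac_at i (W p) z') (u i z') + e / 4.
    apply: Hd => // [j|]; last by rewrite lerDl ltW.
    rewrite /dirac_at; case: ifP => _; first by rewrite lerDl ltW.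
    by apply: Wle; have [] := qp (Tagged K (z' j)).
  by move: le1 le2 lt; rewrite /dirac_at; lra.
Qed.
End FiniteGame.

(** * Capacities with a given density *)

Section SupCapacity.
Context {R : realType} {X : topologicalType} (d : X -> R).
Hypothesis d_itv : forall x, d x \in `[0, 1].
Hypothesis d_usc : forall x a, d x < a -> \forall y \near x, d y < a.

(** For [d] a tensor density this is convertible to [tensor], so the bounds below on the integral
    apply to payoffs. *)
Definition sup_capacity (F : set X) : R := sup (d @` F).

Let d01 x : 0 <= d x <= 1. Proof. by have := d_itv x; rewrite mem01. Qed.

Lemma le_sup_capacity F x : F x -> d x <= sup_capacity F.
Proof.
move=> Fx; apply: ub_le_sup; last by exists x.
by exists 1 => _ [y _ <-]; have /andP[] := d01 y.
Qed.

Lemma sup_capacity_le F a : 0 <= a -> (forall x, F x -> d x <= a) ->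
  sup_capacity F <= a.
Proof.
move=> a0 Fa; have [->|/set0P[x Fx]] := eqVneq F set0.
  by rewrite /sup_capacity image_set0 sup0.
by apply: ge_sup => [|_ [y Fy <-]]; [exists (d x), x|exact: Fa].
Qed.

Lemma sup_capacity_itv F : sup_capacity F \in `[0, 1].
Proof.
rewrite mem01 sup_capacity_le ?andbT//; last by move=> x _; have /andP[] := d01 x.
have [->|/set0P[x Fx]] := eqVneq F set0.
  by rewrite /sup_capacity image_set0 sup0.
by apply: le_trans (le_sup_capacity Fx); have /andP[] := d01 x.
Qed.

Lemma density_sup_capacity x : density sup_capacity x = d x.
Proof. by rewrite /density /sup_capacity image_set1 sup1. Qed.

Lemma sup_capacity_is_possibility : (exists x, d x = 1) ->
  is_possibility sup_capacity.
Proof.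
move=> [x1 dx1]; have ge0 F : 0 <= sup_capacity F.
  by have := sup_capacity_itv F; rewrite mem01 => /andP[].
have le1 F : sup_capacity F <= 1.
  by have := sup_capacity_itv F; rewrite mem01 => /andP[].
split; first split.
- by move=> F _; exact: sup_capacity_itv.
- by apply/eqP; rewrite eq_le le1 -dx1 le_sup_capacity.
- by rewrite /sup_capacity image_set0 sup0.
- by move=> F G _ _ FG; apply: sup_capacity_le => // x /FG; exact: le_sup_capacity.
- move=> F a _ Fa; pose b := (sup_capacity F + a) / 2.
  have [Fb ba] : sup_capacity F < b /\ b < a by split; rewrite midf_lt.
  exists [set x | d x < b]; split.
  + by rewrite openE => x; exact: d_usc.
  + by move=> x Fx /=; apply: le_lt_trans Fb; exact: le_sup_capacity.
  + move=> B _ Bb; apply: le_lt_trans ba; apply: sup_capacity_le.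
      by apply: le_trans (ltW Fb).
    by move=> x /Bb /ltW.
- move=> I A _ _; apply/eqP; rewrite eq_le; apply/andP; split.
    have [[i0 _]|noI] := pselect (exists i : I, True); last first.
      rewrite (_ : \bigcup_i A i = set0); last first.
        by apply/seteqP; split => // x [i]; case: noI; exists i.
      rewrite (_ : [set _ | _ in _] = set0).
        by rewrite /sup_capacity image_set0 sup0.
      by apply/seteqP; split => // x [i]; case: noI; exists i.
    have le_sup i : sup_capacity (A i) <= sup [set sup_capacity (A i) | i in [set: I]].
      by apply: ub_le_sup; [exists 1 => _ [j _ <-]|exists i].
    apply: sup_capacity_le => [|x [i _ Aix]]; first exact: le_trans (le_sup i0).
    exact: le_trans (le_sup_capacity Aix) (le_sup i).
  have [[i0 _]|noI] := pselect (exists i : I, True); last first.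
    rewrite (_ : [set _ | _ in _] = set0) ?sup0//.
    by apply/seteqP; split => // x [i]; case: noI; exists i.
  apply: ge_sup => [|_ [i _ <-]]; first by exists (sup_capacity (A i0)), i0.
  by apply: sup_capacity_le => // x Aix; apply: le_sup_capacity; exists i.
Qed.

Section TInt.
Variables (T : R -> R -> R) (f : X -> R).
Hypotheses (tT : continuous_tnorm T) (f_itv : forall x, f x \in `[0, 1]).

(** The superlevel set at [t = f x] contains [x]. With [tint_sup_capacity_le], this makes the
    integral the supremum of [T (d x) (f x)]. *)
Lemma le_tint_sup_capacity x : T (d x) (f x) <= tint T sup_capacity f.
Proof.
apply: (@le_trans _ _ (T (sup_capacity (f @^-1` `[f x, +oo[%classic)) (f x))).
  apply: (tnorm_le tT) => //; first exact: sup_capacity_itv.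
  by apply: le_sup_capacity; rewrite /= in_itv /= lexx.
apply: ub_le_sup; last by exists (f x) => //; exact: f_itv.
exists 1 => _ [t t01 <-].
by have := tnorm_itv tT (sup_capacity_itv (f @^-1` `[t, +oo[%classic)) t01;
  rewrite mem01 => /andP[].
Qed.

(** On the compact superlevel set at [t] the density has a maximum point [x], where [f x >= t];
    [0 <= b] takes care of empty superlevel sets. *)
Lemma tint_sup_capacity_le b : compact [set: X] -> continuous f -> 0 <= b ->
  (forall x, T (d x) (f x) <= b) -> tint T sup_capacity f <= b.
Proof.
move=> cX cf b0 Tb; apply: ge_sup.
  by exists (T (sup_capacity (f @^-1` `[0, +oo[%classic)) 0), 0 => //; exact: zero_mem01.
move=> _ [t t01 <-]; set F := f @^-1` _.
have [F0|/set0P F0] := eqVneq F set0.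
  apply: le_trans b0; rewrite F0 /sup_capacity image_set0 sup0.
  by apply: tnorm_le_l => //; exact: zero_mem01.
have cF : compact F.
  apply: (subclosed_compact _ cX) => //; apply: preimage_closed => [x _|].
    exact: cf.
  by rewrite set_itvcy; exact: closed_ge.
have [|x Fx xmax] := usc_max cF F0 (g := d).
  by move=> x _ a /d_usc; apply: filterS.
apply: le_trans (Tb x); apply: (tnorm_le tT) => //; first exact: sup_capacity_itv.
  by apply: sup_capacity_le => //; have /andP[] := d01 x.
by move: Fx; rewrite /F /= in_itv /= andbT.
Qed.

End TInt.
End SupCapacity.

(** * Box neighbourhoods and limits of densities along an ultrafilter *)

Lemma nbhs_box (n : nat) (Z : 'I_n -> topologicalType) (z : prod_topology Z)
    (A : set (prod_topology Z)) : nbhs z A ->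
  exists2 U : forall j, set (Z j), (forall j, nbhs (z j) (U j)) &
    forall y : prod_topology Z, (forall j, U j (y j)) -> A y.
Proof.
pose box (U : forall j, set (Z j)) : set (prod_topology Z) :=
  [set y | forall j, U j (y j)].
pose B := filter_from [set U : forall j, set (Z j) | forall j, nbhs (z j) (U j)] box.
have FB : Filter B.
  apply: filter_from_filter; first by exists (fun j => setT) => j; exact: filterT.
  move=> U V zU zV; exists (fun j => U j `&` V j) => [j|y UVy].
    exact: filterI.
  by split => j; have [] := UVy j.
have Bz : B --> z.
  apply/cvg_sup => j V /=; rewrite (@nbhsE (initial_topology
    (fun f : forall i, Z i => f j))) => - [V' [oV zV'] V'V].
  have [W oW WE] := oV.
  exists (dfwith (fun j => setT) j W) => [k|y yB].
    case: dfwithP => [|k' _]; last exact: filterT.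
    by apply: open_nbhs_nbhs; split => //; move: zV'; rewrite -WE.
  by apply: V'V; rewrite -WE /=; have := yB j; rewrite dfwithin.
by move=> /Bz[U zU UA]; exists U => // y; exact: UA.
Qed.

Section UltraLimit.
Context {R : realType} {A : Type} (G : set_system A) {GU : UltraFilter G}.

Lemma compact_ultra_cvg (X : topologicalType) (f : A -> X) :
  compact [set: X] -> exists x : X, f @ G --> x.
Proof.
move=> cX; have [|x [_ xcl]] := cX (f @ G) _; first exact: filterT.
exists x => U xU; have [//|GUc] := in_ultra_setVsetC (f @^-1` U) GU.
by have [y []] := xcl (~` U) U GUc xU.
Qed.

Context {X : topologicalType} (w : A -> X -> R).
Hypothesis w_itv : forall a x, w a x \in `[0, 1].

(** The limit along [G] of the supremum of [w a] over [U], minimised over the neighbourhoods [U]; a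
    pointwise limit need not be upper semicontinuous. *)
Definition limit_density (x : X) : R :=
  inf [set b | exists2 U, nbhs x U & G [set a | forall y, U y -> w a y <= b]].

Let bounds (x : X) :=
  [set b | exists2 U, nbhs x U & G [set a | forall y, U y -> w a y <= b]].

Let bounds1 x : bounds x 1.
Proof.
exists setT; first exact: filterT.
by apply: filterE => a y _; have := w_itv a y; rewrite mem01 => /andP[].
Qed.

Let bounds_ge0 x b : bounds x b -> 0 <= b.
Proof.
move=> [U xU /filter_ex[a wb]]; apply: le_trans (wb x (nbhs_singleton xU)).
by have := w_itv a x; rewrite mem01 => /andP[].
Qed.

Lemma limit_density_itv x : limit_density x \in `[0, 1].
Proof.
rewrite mem01; apply/andP; split.
  by apply: lb_le_inf; [exists 1; exact: bounds1|move=> b; exact: bounds_ge0].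
by apply: ge_inf; [exists 0 => b; exact: bounds_ge0|exact: bounds1].
Qed.

Lemma limit_density_lt x b : limit_density x < b ->
  exists2 U, nbhs x U & G [set a | forall y, U y -> w a y <= b].
Proof.
have hi : has_inf (bounds x).
  by split; [exists 1; exact: bounds1|exists 0 => c; exact: bounds_ge0].
move=> xb; have e0 : 0 < b - limit_density x by rewrite subr_gt0.
have [c [U xU Uc] cb] := inf_adherent e0 hi; exists U => //.
apply: filterS Uc => a Ha y /Ha /le_trans; apply.
by apply: ltW; move: cb; rewrite addrC subrK.
Qed.

(** Otherwise the ultrafilter property would make [b] an eventual bound on [U]. The points obtained
    may move with [a]. *)
Lemma lt_limit_density x b U : b < limit_density x -> nbhs x U ->
  G [set a | exists2 y, U y & b < w a y].
Proof.
move=> bx xU.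
have [//|GN] := in_ultra_setVsetC [set a | exists2 y, U y & b < w a y] GU.
move: bx; rewrite ltNge => /negP[]; apply: ge_inf.
  by exists 0 => c; exact: bounds_ge0.
exists U => //; apply: filterS GN => a aN y Uy.
by rewrite leNgt; apply/negP => by_; apply: aN; exists y.
Qed.

Lemma limit_density_usc x b : limit_density x < b ->
  \forall y \near x, limit_density y < b.
Proof.
move=> xb; have [c xc cb] : exists2 c, limit_density x < c & c < b.
  by exists ((limit_density x + b) / 2); rewrite midf_lt.
have [U xU Uc] := limit_density_lt xc.
have := nbhs_interior xU; apply: filterS => y yU; apply: le_lt_trans cb.
by apply: ge_inf; [exists 0 => e; exact: bounds_ge0|exists U].
Qed.

Lemma limit_density_cvg (f : A -> X) x e : 0 < e -> f @ G --> x ->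
  G [set a | w a (f a) <= limit_density x + e].
Proof.
move=> e0 fx; have [|U xU Uc] := @limit_density_lt x (limit_density x + e).
  by rewrite ltrDl.
have GfU : G [set a | U (f a)] := fx U xU.
by apply: filterS2 GfU Uc => a fU Ua; exact: Ua.
Qed.

(** Points where [w a] is 1 converge along the ultrafilter, and by [limit_density_cvg] the limit
    density is at least 1 at their limit. *)
Lemma limit_density_max : compact [set: X] -> (forall a, exists x, w a x = 1) ->
  exists x, limit_density x = 1.
Proof.
move=> cX /choice[f wf]; have [x fx] := compact_ultra_cvg f cX.
exists x; apply/eqP; rewrite eq_le.
have := limit_density_itv x; rewrite mem01 => /andP[_ ->] /=.
apply/ler_addgt0Pr => e e0; have [a] := filter_ex (limit_density_cvg e0 fx).
by rewrite /= wf.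
Qed.

End UltraLimit.

Lemma possibility_max (R : realType) (X : topologicalType) (nu : set X -> R) :
  hausdorff_space X -> compact [set: X] -> is_possibility nu ->
  exists x, density nu x = 1.
Proof.
move=> hX cX nuP; have nuC := possibility_is_capacity nuP.
have nuE := possibility_supE hX nuP closedT; rewrite (capacityT nuC) in nuE.
have [X0|/set0P X0] := eqVneq [set: X] set0.
  by move: nuE => /eqP; rewrite X0 image_set0 sup0 oner_eq0.
have [x _ xmax] := usc_max cX X0 (capacity_density_usc hX nuC).
exists x; apply/eqP; rewrite eq_le; apply/andP; split.
  have := capacity_itv nuC (closed_pt hX (x := x)).
  by rewrite in_itv /= => /andP[].
rewrite nuE; apply: ge_sup => [|_ [y _ <-]]; last exact: xmax.
by exists (density nu x), x.
Qed.

(** * Approximate equilibria on finite subsets of the spaces *)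

Section Approximation.
Context {R : realType} (star ast : R -> R -> R) (n : nat) (Z : 'I_n -> topologicalType).
Hypotheses (star_tnorm : continuous_tnorm star) (ast_tnorm : continuous_tnorm ast).
Variable u : 'I_n -> (forall j, Z j) -> R.
Hypotheses (n_gt0 : (0 < n)%N) (u_itv : forall i z, u i z \in `[0, 1]).
Hypothesis Z_nonempty : forall j, [set: Z j] !=set0.

Local Notation value := (value star ast).

(** The finite game is played on [s j] with a base point added to keep it nonempty, and its
    densities are extended by 0, so a [z] with a coordinate outside has value 0. *)
Lemma approximate_equilibrium (s : forall j, seq (Z j)) e : 0 < e ->
  exists w : forall j, Z j -> R,
  [/\ forall j y, w j y \in `[0, 1], forall j, exists y, w j y = 1 &
  forall i x z, x \in s i -> exists2 z' : forall j, Z j, z' i = x &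
    value (fun j => w j (z j)) (u i z)
    <= value (fun j => if j == i then 1 else w j (z' j)) (u i z') + e].
Proof.
move=> e0; pose z0 j : Z j := sval (cid (Z_nonempty j)).
pose K j : finType := seq_sub (z0 j :: s j).
pose lift (k : forall j, K j) : forall j, Z j := fun j => val (k j).
have K0 j : K j by exists (z0 j); rewrite mem_head.
have [w [w01 wmax weq]] := finite_game star_tnorm ast_tnorm n_gt0
  (fun i k => u_itv i (lift k)) K0 e0.
pose W j (y : Z j) : R := if (insub y : option (K j)) is Some k then w j k else 0.
have WE j (k : K j) : W j (val k) = w j k by rewrite /W valK.
have W01 j y : W j y \in `[0, 1].
  by rewrite /W; case: insubP => // _; exact: zero_mem01.
exists W; split => // [j|i x z xs].
  by have [k wk] := wmax j; exists (val k); rewrite WE.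
have xK : x \in z0 i :: s i by rewrite inE xs orbT.
have [inK|/existsNP[j zj]] := pselect (forall j, z j \in z0 j :: s j).
  pose k : forall j, K j := fun j => SeqSub (inK j).
  have [k' k'x le] := weq i (SeqSub xK) k; exists (lift k').
    by rewrite /lift k'x.
  have kE : lift k = z by [].
  rewrite -{2}kE; congr (_ <= _ + _): le.
    by congr (star _ _); apply: eq_bigr => j _; rewrite -WE.
  by congr (star _ _); apply: eq_bigr => j _; rewrite -WE.
have W0 : W j (z j) = 0 by rewrite /W insubN//; apply/negP.
exists (dfwith z i x); first by rewrite dfwithin.
apply: (@le_trans _ _ 0); first by rewrite -W0; apply: value_le_coord.
apply: addr_ge0; last exact: ltW.
have := value_itv star_tnorm ast_tnorm
  (a := fun j => if j == i then 1 else W j (dfwith z i x j)) _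
  (u_itv i (dfwith z i x)).
rewrite mem01 => /(_ _)/andP[] // j'.
by case: ifP => // _; exact: one_mem01.
Qed.
End Approximation.

Section Stages.
Variables (n : nat) (Z : 'I_n -> topologicalType).

(** Finite sets of strategies tested as deviations, with an index [m] for the precision
    [1 / (m + 1)]. *)
Definition stage : Type := ((forall j, seq (Z j)) * nat)%type.

Definition stage_filter : set_system stage :=
  filter_from [set: stage]
    (fun a => [set b : stage | (forall j, {subset a.1 j <= b.1 j}) /\ (a.2 <= b.2)%N]).

Lemma stage_filter_proper : ProperFilter stage_filter.
Proof.
apply: filter_from_proper; last by move=> a _; exists a; split=> [j x|].
apply: filter_from_filter; first by exists (fun j => [::], 0%N).
move=> a b _ _; exists (fun j => a.1 j ++ b.1 j, maxn a.2 b.2) => // c [sc].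
rewrite /= geq_max => /andP[ac bc].
by split; split => // j x xj; apply: sc; rewrite /= mem_cat xj ?orbT.
Qed.

End Stages.

(** * Existence of an equilibrium, as a limit of approximate ones *)

Unset Implicit Arguments.

Theorem theorem4 (R : realType) (n : nat) (hn : (1 <= n)%N)
    (Z : 'I_n -> topologicalType)
    (Z_nonempty : forall j, [set: Z j] !=set0)
    (Z_compact : forall j, compact [set: Z j])
    (Z_hausdorff : forall j, hausdorff_space (Z j))
    (u : 'I_n -> prod_topology Z -> R)
    (u_itv : forall i z, u i z \in `[0, 1])
    (u_continuous : forall i, continuous (u i))
    (star ast : R -> R -> R)
    (star_tnorm : continuous_tnorm star) (ast_tnorm : continuous_tnorm ast) :
  let eu (i : 'I_n) (nu : forall j, possibility R (Z j)) : R :=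
    tint star (tensor ast nu) (u i) in
  exists nu : forall j, possibility R (Z j), nash_min_equilibrium eu nu.
Proof.
move=> eu; have stageF := stage_filter_proper Z.
have [G [GU FG]] := ultraFilterLemma stageF.
have inv_gt0 m : 0 < m.+1%:R^-1 :> R by rewrite invr_gt0 ltr0n.
have [w Hw] := choice (fun a : stage Z => approximate_equilibrium star_tnorm ast_tnorm
  hn u_itv Z_nonempty a.1 (inv_gt0 a.2)).
have w01 j a y : w a j y \in `[0, 1] by have [w01 _ _] := Hw a; exact: w01.
pose d j : Z j -> R := limit_density G (fun a => w a j).
have d01 j y : d j y \in `[0, 1] by exact: limit_density_itv.
have dmax j : exists y, d j y = 1.
  apply: limit_density_max => // a.
  by have [_ wmax _] := Hw a; exact: wmax.
have dusc j y a : d j y < a -> \forall z \near y, d j z < a.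
  exact: limit_density_usc.
pose nu j := Possibility (sup_capacity_is_possibility (d01 j) (dusc j) (dmax j)).
have densE j y : density (nu j) y = d j y by exact: density_sup_capacity.
have dens01 (mu : forall j, possibility R (Z j)) j y : density (mu j) y \in `[0, 1].
  exact/(capacity_itv (possibility_is_capacity (possibilityP (mu j))))/closed_pt.
exists nu => i s'; set nu' := dfwith nu i s'.
have le_eu' (z : prod_topology Z) :
    value star ast (fun j => density (nu' j) (z j)) (u i z) <= eu i nu'.
  apply: (le_tint_sup_capacity (d := tensor_density ast nu')) => // y.
  exact: tensor_density_itv.
(* Where its density is 1, [s'] is worth at least the Dirac capacity at [x], so only the deviation
   [x] has to be tested. *)
have [x s'x] := possibility_max (@Z_hausdorff i) (@Z_compact i) (possibilityP s').
have eu'_ge0 : 0 <= eu i nu'.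
  pose z : prod_topology Z := fun j => sval (cid (Z_nonempty j)).
  apply: le_trans (le_eu' z).
  have := value_itv star_tnorm ast_tnorm (fun j => dens01 nu' j (z j)) (u_itv i z).
  by rewrite mem01 => /andP[].
apply: (tint_sup_capacity_le (d := tensor_density ast nu)) => //.
- by move=> y; exact: tensor_density_itv.
- by move=> y b; exact: tensor_density_usc.
- have := @tychonoff _ Z (fun j => setT) (fun j => @Z_compact j).
  by congr compact; apply/seteqP; split.
move=> z; rewrite -[X in X <= _]/(value star ast (fun j => density (nu j) (z j)) (u i z)).
(* Three errors of [e / 3]: moving from [z] to a nearby point at some stage, the approximate
   equilibrium of that stage, and the return to the limit densities. *)
apply/ler_addgt0Pr => e e0; have e30 : 0 < e / 3 by rewrite divr_gt0.
have [r r0 Hr] := value_ucont n star_tnorm ast_tnorm e30.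
have uz : nbhs z [set y | u i z - r < u i y].
  by apply: (cvgr_gt _ (@u_continuous i z)); rewrite ltrBlDr ltrDl.
(* A box, because near-optimal points are chosen in each coordinate separately. *)
have [U zU Uu] := nbhs_box uz.
have near_z : G [set a | forall j, exists2 y, U j y & d j (z j) - r < w a j y].
  apply: filter_forall => j.
  apply: lt_limit_density (zU j); first by [].
  by rewrite ltrBlDr ltrDl.
pose good a (y : prod_topology Z) := y i = x /\
  value star ast (fun j => density (nu j) (z j)) (u i z) <=
  value star ast (fun j => if j == i then 1 else w a j (y j)) (u i y) + (e / 3 + e / 3).
have good_ex : G [set a | exists y, good a y].
  pose m := Num.bound (e / 3)^-1.
  have late : G [set a : stage Z | x \in a.1 i /\ (m <= a.2)%N].
    apply: FG; exists (dfwith (fun j => [::]) i [:: x], m) => // a [sa ma].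
    by split => //; apply: sa; rewrite /= dfwithin mem_head.
  apply: filterS2 near_z late => a /fin_all_exists2[y yU yw] [xa ma].
  have [_ _ /(_ i x y xa)[y' y'x le]] := Hw a.
  exists y'; split => //.
  have ae3 : a.2.+1%:R^-1 <= e / 3.
    have ie30 : 0 < (e / 3)^-1 by rewrite invr_gt0.
    rewrite -[leRHS]invrK lef_pV2 ?posrE ?ltr0n//.
    apply: le_trans (ltW (archi_boundP (ltW ie30))) _.
    by rewrite ler_nat; exact: leqW.
  apply: (@le_trans _ _ (value star ast (fun j => w a j (y j)) (u i y) + e / 3)).
    apply: Hr => // [j|]; first by rewrite densE -lerBlDr ltW.
    by rewrite -lerBlDr ltW//; exact: Uu.
  by rewrite addrA lerD2r; apply: le_trans le _; rewrite lerD2l.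
(* Stages without a good point get the default [z]; they are negligible for [G]. *)
pose f a : prod_topology Z := xget z (good a).
have fgood : G [set a | good a (f a)].
  by apply: filterS good_ex => a /(xgetPex z).
have Zc : compact [set: prod_topology Z].
  have := @tychonoff _ Z (fun j => setT) (fun j => @Z_compact j).
  by congr compact; apply/seteqP; split.
have [y fy] := @compact_ultra_cvg _ G _ _ f Zc.
have fyj j : (fun a => f a j) @ G --> y j.
  exact: (cvg_comp _ _ fy (@proj_continuous _ Z j y)).
have yx : y i = x.
  apply: (cvg_unique (@Z_hausdorff i) (fyj i)) => V xV.
  suff : G [set a | V (f a i)] by [].
  by apply: filterS fgood => a [fx _] /=; rewrite fx; exact: nbhs_singleton.
have near_y : G [set a | forall j, w a j (f a j) <= d j (y j) + r].
  by apply: filter_forall => j; exact: limit_density_cvg.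
have uy : nbhs y [set y' | u i y' < u i y + r].
  by apply: (cvgr_lt _ (@u_continuous i y)); rewrite ltrDl.
have uf : G [set a | u i (f a) < u i y + r] := fy _ uy.
have [a [[[fx Vf] fd] fu]] := filter_ex (filterI (filterI fgood near_y) uf).
(* In coordinate [i] the weight 1 is matched by [s'], since [y i = x]; in the others
   [limit_density_cvg] bounds the weights at the moving points [f a]. *)
have le_y : value star ast (fun j => if j == i then 1 else w a j (f a j)) (u i (f a))
    <= value star ast (fun j => density (nu' j) (y j)) (u i y) + e / 3.
  apply: Hr => // [j|j|]; last exact: ltW.
    by case: ifP => // _; exact: one_mem01.
  case: eqVneq => [->|ji].
    by rewrite /nu' dfwithin yx s'x lerDl ltW.
  by rewrite /nu' dfwithout 1?eq_sym// densE; exact: fd.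
apply: le_trans Vf _.
have -> : eu i nu' + e = (eu i nu' + e / 3) + (e / 3 + e / 3) by lra.
by rewrite lerD2r (le_trans le_y)// lerD2r.
Qed.
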